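(* Let $m\ge 2$ be an integer. There exists a vector of weights $\pi\in\mathbb{N}^{2^m}$ such that the extended binary Hamming code $\widetilde{\mathcal{H}}_m$ is a $2$-perfect $\pi$-code if and only if $m=2$ or $m=4$.
   Context: $\mathbb{N}$ denotes the positive integers. For a vector of weights $\pi=(\pi_1,\dots,\pi_n)\in\mathbb{N}^n$, the $\pi$-weight of $\mathbf{x}=(x_1,\dots,x_n)\in\mathbb{F}_2^n$ is $w_\pi(\mathbf{x})=\sum_{i=1}^n\pi_i x_i$ (with the entries $x_i$ regarded as integers $0,1$), the $\pi$-distance is $d_\pi(\mathbf{x},\mathbf{y})=w_\pi(\mathbf{x}-\mathbf{y})$, and $S_\pi(\mathbf{x};r)=\{\mathbf{y}\in\mathbb{F}_2^n: d_\pi(\mathbf{x},\mathbf{y})\le r\}$. A subset $C\subset\mathbb{F}_2^n$ is an $r$-perfect $\pi$-code if the spheres $S_\pi(\mathbf{c};r)$, $\mathbf{c}\in C$, are mutually disjoint and their union is $\mathbb{F}_2^n$. The extended binary Hamming code $\widetilde{\mathcal{H}}_m$ is the linear code of length $2^m$ over $\mathbb{F}_2$ with parity check matrix the $(m+1)\times 2^m$ binary matrix $\widetilde{H}_m$ whose first row is the all-one vector and whose remaining $m$ rows form an $m\times 2^m$ matrix whose columns are, in order, the binary representations of $0,1,\dots,2^m-1$. *)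

(* Defs.v *)
From mathcomp Require Import all_boot all_order all_algebra.

Set Implicit Arguments.
Unset Strict Implicit.
Unset Printing Implicit Defensive.

Import GRing.Theory.

Definition positive_weights (n : nat) (pi : 'rV[nat]_n) : Prop :=
  forall i : 'I_n, 0 < pi ord0 i.

(* An element of 'F_2 is an ordinal, so [x ord0 i : nat] is the integer 0 or 1. *)
Definition wt (n : nat) (pi : 'rV[nat]_n) (x : 'rV['F_2]_n) : nat :=
  \sum_(i < n) pi ord0 i * (x ord0 i : nat).

Definition wdist (n : nat) (pi : 'rV[nat]_n) (x y : 'rV['F_2]_n) : nat :=
  wt pi (x - y)%R.

Definition wsphere (n : nat) (pi : 'rV[nat]_n) (x : 'rV['F_2]_n) (r : nat) :
    {set 'rV['F_2]_n} :=
  [set y | wdist pi x y <= r].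

Definition perfect_code (n : nat) (pi : 'rV[nat]_n) (r : nat)
    (C : {set 'rV['F_2]_n}) : Prop :=
  {in C &, forall c c', c != c' -> [disjoint wsphere pi c r & wsphere pi c' r]}
  /\ \bigcup_(c in C) wsphere pi c r = [set: 'rV['F_2]_n].

(* Column j is the m-bit binary representation of j, most significant bit in
   the top row. *)
Definition binary_mx (m : nat) : 'M['F_2]_(m, 2 ^ m) :=
  \matrix_(i < m, j < 2 ^ m) ((odd (j %/ 2 ^ (m - i.+1)))%:R)%R.

Definition ext_hamming_mx (m : nat) : 'M['F_2]_(1 + m, 2 ^ m) :=
  col_mx (const_mx 1%R) (binary_mx m).

Definition ext_hamming_code (m : nat) : {set 'rV['F_2]_(2 ^ m)} :=
  [set x | (ext_hamming_mx m *m x^T == 0)%R].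

(* Main.v *)
Require Import Defs.
From mathcomp Require Import all_boot all_order all_algebra.
From mathcomp Require Import zify.

(** The code is 2-perfect iff the ball of radius 2 around 0 meets every coset
exactly once.  With [A] the set of coordinates of weight 1, the vectors of even
Hamming weight in this ball are 0 and the pairs from [A], so every nonzero
vector of F_2^m is a sum of exactly one pair of columns indexed by [A].  If [p]
and [q] count the columns of [A] with first bit 1 and 0, counting the pair sums
with first bit 1 gives p q = 2^(m-1), and counting all of them gives
(p+q)(p+q-1) = 2(2^m - 1), that is (p-q)^2 = p+q-2.  Since [p] and [q] are
powers of 2, the smaller one divides 2, which leaves only m = 2 and m = 4 (so
the Ramanujan-Nagell solution m = 12 of the second equation alone never arises).
Conversely the columns 0, 1, 2 for m = 2 and 0, 1, 2, 4, 8, 15 for m = 4 have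
the pair-sum property; all other coordinates get weight 2. *)

Set Implicit Arguments.
Unset Strict Implicit.
Unset Printing Implicit Defensive.

Import GRing.Theory.

(** * Perfect codes in terms of syndromes and supports *)

Lemma F2_cases (a : 'F_2) : a = 0%R \/ a = 1%R.
Proof. by case: a => [[|[|//]] ?]; [left|right]; apply: val_inj. Qed.

Lemma oppmx_F2 (p q : nat) (M : 'M['F_2]_(p, q)) : (- M = M)%R.
Proof.
apply/matrixP => i j; rewrite mxE.
by case: (F2_cases (M i j)) => ->; apply/eqP.
Qed.

Lemma addmx_F2 (p q : nat) (M N : 'M['F_2]_(p, q)) : ((M + N == 0) = (M == N))%R.
Proof. by rewrite -{1}[N]oppmx_F2 subr_eq0. Qed.

Lemma natr_F2 (k : nat) : (k%:R = (odd k)%:R :> 'F_2)%R.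
Proof. by apply: val_inj; rewrite /= !val_Fp_nat // !modn2; case: (odd k). Qed.

Lemma natr_bool_F2_inj (b b' : bool) : (b%:R = b'%:R :> 'F_2)%R -> b = b'.
Proof. by case: b b' => [] []. Qed.

(** A point [z] lies in the sphere around a codeword [c] iff [c - z], which has the syndrome of [z],
    lies in the ball around 0. So disjoint spheres mean that syndromes are injective on that ball,
    and covering means that the ball attains every syndrome. *)
Lemma perfect_syndromeP (n r k : nat) (pi : 'rV[nat]_n) (H : 'M['F_2]_(k, n)) :
  perfect_code pi r [set x : 'rV['F_2]_n | (H *m x^T == 0)%R] <->
  (forall x y, wt pi x <= r -> wt pi y <= r ->
     (H *m x^T = H *m y^T)%R -> x = y) /\
  (forall x, exists2 y, wt pi y <= r & (H *m x^T = H *m y^T)%R).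
Proof.
have HB x y : (H *m (x - y)^T = H *m x^T - H *m y^T)%R by rewrite linearB mulmxBr.
split=> [[disj cov] | [inj surj]]; split.
(* If [x != y], then [x] lies in the spheres around the distinct codewords [x - y] and 0. *)
- move=> x y hx hy Hxy; apply/eqP; rewrite -subr_eq0; apply/negPn/negP => nz.
  have C0 : 0%R \in [set x : 'rV['F_2]_n | (H *m x^T == 0)%R] by rewrite inE linear0 mulmx0.
  have Cxy : (x - y)%R \in [set x : 'rV['F_2]_n | (H *m x^T == 0)%R].
    by rewrite inE HB Hxy subrr.
  have /pred0P/(_ x) := disj _ _ Cxy C0 nz.
  by rewrite /= !inE /wdist addrAC subrr !sub0r !oppmx_F2 hx hy.
- move=> x; have := in_setT x; rewrite -cov => /bigcupP [c].
  rewrite !inE => /eqP Hc le_r; exists (c - x)%R => //.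
  by rewrite HB Hc sub0r oppmx_F2.
- move=> c c'; rewrite !inE => /eqP Hc /eqP Hc' /negP ncc'.
  apply/pred0P => z /=; rewrite !inE; apply/negP => /andP [h h'].
  apply: ncc'; apply/eqP/(addIr (- z)%R)/inj => //.
  by rewrite !HB Hc Hc'.
- apply/setP => x; rewrite inE; have [y le_r Hxy] := surj x.
  apply/bigcupP; exists (x - y)%R.
    by rewrite inE HB Hxy subrr.
  by rewrite inE /wdist addrAC subrr sub0r oppmx_F2.
Qed.

(** Over F_2 every vector is the indicator of its support, so cosets can be studied through sets of
    coordinates. *)
Definition indicator (n : nat) (B : {set 'I_n}) : 'rV['F_2]_n :=
  \row_i ((i \in B)%:R)%R.

Lemma indicator_inj (n : nat) : injective (@indicator n).
Proof.
move=> B B' /rowP eqB; apply/setP => i; have := eqB i.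
by rewrite !mxE => /natr_bool_F2_inj.
Qed.

Lemma indicator_surj (n : nat) (x : 'rV['F_2]_n) : exists B, x = indicator B.
Proof.
exists [set i | x ord0 i == 1%R]; apply/rowP => i; rewrite mxE inE.
by case: (F2_cases (x ord0 i)) => ->.
Qed.

Lemma wt_indicator (n : nat) (pi : 'rV[nat]_n) (B : {set 'I_n}) :
  wt pi (indicator B) = \sum_(i in B) pi ord0 i.
Proof.
rewrite /wt [RHS]big_mkcond; apply: eq_bigr => i _; rewrite mxE.
by case: (i \in B); rewrite ?muln1 ?muln0.
Qed.

(** The all-one row of the matrix records the parity of the support, the remaining rows its column
    sum. *)
Lemma ext_hamming_syndromeP (m : nat) (B B' : {set 'I_(2 ^ m)}) :
  (ext_hamming_mx m *m (indicator B)^T = ext_hamming_mx m *m (indicator B')^T)%R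
  <-> odd #|B| = odd #|B'| /\
      (\sum_(i in B) col i (binary_mx m) = \sum_(i in B') col i (binary_mx m))%R.
Proof.
have top D : (const_mx 1 *m (indicator D)^T = (odd #|D|)%:R%:M :> 'M['F_2]_1)%R.
  apply/matrixP => i j; rewrite !ord1 !mxE eqxx mulr1n -natr_F2 -sum1_card natr_sum.
  rewrite [RHS]big_mkcond; apply: eq_bigr => k _; rewrite !mxE mul1r.
  by case: (k \in D).
have bot D : (binary_mx m *m (indicator D)^T = \sum_(i in D) col i (binary_mx m))%R.
  apply/colP => r; rewrite summxE mxE [RHS]big_mkcond; apply: eq_bigr => k _.
  by rewrite !mxE; case: (k \in D); rewrite ?mulr1 ?mulr0.
rewrite /ext_hamming_mx !mul_col_mx !top !bot; split=> [/eq_col_mx [e ->]|[-> ->]//].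
split=> //; have /matrixP/(_ ord0 ord0) := e.
by rewrite !mxE !eqxx !mulr1n => /natr_bool_F2_inj.
Qed.

Lemma perfect_ext_hammingP (m r : nat) (pi : 'rV[nat]_(2 ^ m)) :
  let c i := col i (binary_mx m) in
  let w (B : {set 'I_(2 ^ m)}) := \sum_(i in B) pi ord0 i in
  perfect_code pi r (ext_hamming_code m) <->
  (forall B B' : {set 'I_(2 ^ m)}, w B <= r -> w B' <= r -> odd #|B| = odd #|B'| ->
     (\sum_(i in B) c i = \sum_(i in B') c i)%R -> B = B') /\
  (forall B : {set 'I_(2 ^ m)}, exists B' : {set 'I_(2 ^ m)}, [/\ w B' <= r, odd #|B| = odd #|B'|
     & (\sum_(i in B) c i = \sum_(i in B') c i)%R]).
Proof.
move=> c w; rewrite /ext_hamming_code perfect_syndromeP.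
split=> -[inj surj]; split.
- move=> B B' hB hB' hodd hsum; apply: indicator_inj.
  by apply: inj; rewrite ?wt_indicator //; apply/ext_hamming_syndromeP.
- move=> B; have [y] := surj (indicator B); have [B' ->] := indicator_surj y.
  by rewrite wt_indicator => ? /ext_hamming_syndromeP [? ?]; exists B'.
- move=> x y; have [B ->] := indicator_surj x; have [B' ->] := indicator_surj y.
  rewrite !wt_indicator => hB hB' /ext_hamming_syndromeP [? ?].
  by rewrite (inj B B').
- move=> x; have [B ->] := indicator_surj x; have [B' [? ? ?]] := surj B.
  by exists (indicator B'); rewrite ?wt_indicator //; apply/ext_hamming_syndromeP.
Qed.

(** * Counting in sets with unique pair sums *)

Definition unique_pair_sums (T : finType) (V : nmodType) (c : T -> V)
    (A : {set T}) : Prop :=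
  (forall v, v != 0%R -> exists i j, [/\ i \in A, j \in A & (c i + c j)%R = v])
  /\ (forall i j k l, i \in A -> j \in A -> k \in A -> l \in A -> i != j ->
        (c i + c j = c k + c l)%R -> [set i; j] = [set k; l]).

Lemma eq_set2 (T : finType) (i j k l : T) : [set i; j] = [set k; l] ->
  (i, j) = (k, l) \/ (i, j) = (l, k).
Proof.
move=> e; have: i \in [set k; l] by rewrite -e set21.
have: j \in [set k; l] by rewrite -e set22.
have: k \in [set i; j] by rewrite e set21.
have: l \in [set i; j] by rewrite e set22.
by rewrite !inE => /pred2P[] ? /pred2P[] ? /pred2P[] ? /pred2P[] ?; subst; auto.
Qed.

(** Sort the ordered pairs of [A] by their sum: 0 arises from the [#|A|] diagonal pairs, each of the
    other 2^m - 1 vectors from exactly two pairs. The resulting identity is stated without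
    subtraction. *)
Lemma card_unique_pair_sums (T : finType) (m : nat) (c : T -> 'cV['F_2]_m)
    (A : {set T}) : injective c -> unique_pair_sums c A ->
  #|A| ^ 2 + 2 = #|A| + 2 ^ m.+1.
Proof.
move=> c_inj [ex uniq].
pose N v := #|[set u : T * T in setX A A | (c u.1 + c u.2)%R == v]|.
have N0 : N 0%R = #|A|.
  rewrite /N -(@card_imset _ _ (fun i => (i, i)) (mem A)) => [|i j []//].
  apply: eq_card => -[i j]; rewrite !inE /= addmx_F2 (inj_eq c_inj).
  apply/andP/imsetP => [[/andP [Ai _] /eqP <-]|[k Ak [-> ->]]]; first by exists i.
  by rewrite Ak.
have NS v : v != 0%R -> N v = 2.
  move=> v0; have [i [j [Ai Aj ev]]] := ex v v0.
  have nij : i != j.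
    by apply: contra v0 => /eqP eij; rewrite -ev eij addmx_F2.
  have -> : 2 = #|[set (i, j); (j, i)]| by rewrite cards2 xpair_eqE negb_and nij.
  apply: eq_card => -[k l]; rewrite !inE /=; apply/andP/orP.
    case=> /andP [Ak Al] /eqP ekl.
    have [|->|->] := @eq_set2 _ k l i j; try by [left|right].
    by apply/esym/uniq => //; rewrite ev.
  by case=> /eqP [-> ->]; rewrite Ai Aj ?ev // addrC ev.
have : #|A| ^ 2 = \sum_v N v.
  rewrite -mulnn -cardsX -sum1_card.
  rewrite (partition_big (fun u : T * T => (c u.1 + c u.2)%R) xpredT) //=.
  by apply: eq_bigr => v _; rewrite /N -sum1_card; apply: eq_bigl => u; rewrite inE.
rewrite (bigD1 0%R) //= N0 (eq_bigr (fun=> 2)) // => ->.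
rewrite sum_nat_const.
have := cardC1 (0%R : 'cV['F_2]_m); rewrite card_mx muln1 card_Fp //.
have -> : #|predC1 (0%R : 'cV['F_2]_m)| = #|[pred i | i != (0%R : 'cV['F_2]_m)]| by [].
have := expn_gt0 2 m; rewrite expnS.
set N1 := #|_|; lia.
Qed.

Lemma card_coordinate1 (m : nat) (r : 'I_m.+1) :
  #|[set v : 'cV['F_2]_m.+1 | v r ord0 == 1%R]| = 2 ^ m.
Proof.
set V1 := [set _ | _].
(* Translation by the all-one vector flips coordinate [r]. *)
have shift : #|~: V1| = #|V1|.
  rewrite -(card_preimset _ (addIr (const_mx 1 : 'cV['F_2]_m.+1)%R)).
  apply: eq_card => v; rewrite !inE !mxE.
  by case: (F2_cases (v r ord0)) => ->.
have := cardsC V1; rewrite shift card_mx muln1 card_Fp // expnS; lia.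
Qed.

(** A pair sum has coordinate [r] equal to 1 exactly when the two summands differ there. Hence
    addition maps [setX A1 A0] bijectively onto the vectors with that coordinate 1. *)
Lemma card_mixed_pair_sums (T : finType) (m : nat) (c : T -> 'cV['F_2]_m.+1)
    (A : {set T}) (r : 'I_m.+1) : unique_pair_sums c A ->
  #|[set i in A | c i r ord0 == 1%R]| * #|A :\: [set i in A | c i r ord0 == 1%R]|
  = 2 ^ m.
Proof.
move=> [ex uniq]; set A1 := [set _ in _ | _]; set A0 := A :\: A1.
have A0E i : (i \in A0) = (i \in A) && (c i r ord0 == 0%R).
  rewrite !inE; case: (i \in A) => //=.
  by case: (F2_cases (c i r ord0)) => ->.
have A1E i : (i \in A1) = (i \in A) && (c i r ord0 == 1%R) by rewrite inE.
rewrite -(card_coordinate1 r) -cardsX.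
rewrite -(@card_in_imset _ _ (fun u : T * T => (c u.1 + c u.2)%R) (mem (setX A1 A0))).
  apply: eq_card => v; rewrite [RHS]inE; apply/imsetP/idP => [[[i j]]|/eqP v1].
    rewrite in_setX A0E A1E /= => /andP [/andP [_ /eqP i1] /andP [_ /eqP j0]] ->.
    by rewrite mxE i1 j0.
  have [|i [j [Ai Aj ev]]] := ex v.
    by apply/eqP => v0; move: v1; rewrite v0 mxE.
  move: v1; rewrite -ev mxE.
  case: (F2_cases (c i r ord0)) => ei; case: (F2_cases (c j r ord0)) => ej;
    rewrite ei ej => // _.
    by exists (j, i); rewrite ?in_setX ?A0E ?A1E /= ?Ai ?Aj ?ei ?ej //= addrC.
  by exists (i, j); rewrite ?in_setX ?A0E ?A1E /= ?Ai ?Aj ?ei ?ej.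
move=> [i j] [k l]; rewrite !in_setX !A0E !A1E /=.
move=> /andP [/andP [Ai /eqP i1] /andP [Aj /eqP j0]].
move=> /andP [/andP [Ak /eqP k1] /andP [Al /eqP l0]] e.
have nij : i != j by apply/eqP => eij; move: i1; rewrite eij j0.
have /eq_set2 [//|[eil _]] := uniq i j k l Ai Aj Ak Al nij e.
by move: i1; rewrite eil l0.
Qed.

(** Both factors are powers of 2, so the smaller, [p], divides [q]. It then divides every term of
    the quadratic equation but the 2, hence also 2. *)
Lemma pow2_mul_square_eq (p q m : nat) : p * q = 2 ^ m -> 0 < m ->
  (p + q) ^ 2 + 2 = p + q + 2 ^ m.+2 -> m = 1 \/ m = 3.
Proof.
wlog le_pq : p q / p <= q.
  move=> th; case: (leqP p q) => [|/ltnW] le_pq; first exact: th.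
  by rewrite mulnC (addnC p); apply: th.
move=> pq m0 eq2.
have p2 : p %| 2.
  have /(dvdn_pfactor _ _ (isT : prime 2)) [a _ pa] : p %| 2 ^ m by rewrite -pq dvdn_mulr.
  have /(dvdn_pfactor _ _ (isT : prime 2)) [b _ qb] : q %| 2 ^ m by rewrite -pq dvdn_mull.
  have pdq : p %| q by rewrite pa qb dvdn_exp2l // -(@leq_exp2l 2) // -pa -qb.
  rewrite -(@dvdn_addr ((p + q) ^ 2)); last by rewrite -mulnn dvdn_mulr // dvdn_addr.
  rewrite eq2; apply: dvdn_add; first by rewrite dvdn_add.
  by rewrite 2!expnS -pq mulnA dvdn_mull // dvdn_mulr.
have {}p2 : p = 1 \/ p = 2 by case: p p2 {pq eq2 le_pq} => [|[|[|p]]] // /dvdn_leq; auto; lia.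
have pow2m : 2 ^ m.+2 = 4 * (p * q) by rewrite pq !expnS; lia.
(* For p = 1 the equation reads q^2 - 3q + 2 = 0, where q = 1 would give m = 0; for p = 2 it reads
   q^2 - 5q + 4 = 0, where q >= p excludes q = 1. *)
case: p2 => ep; subst p.
  have q2 : q = 2 \/ q = 1 by nia.
  case: q2 => eq; subst q; move: pq.
    by move/(@expnI 2 isT 1); auto.
  by move/(@expnI 2 isT 0) => e; rewrite -e in m0.
have q4 : q = 4 by nia.
by subst q; move: pq => /(@expnI 2 isT 3); auto.
Qed.

Lemma unique_pair_sums_dim (T : finType) (m : nat) (c : T -> 'cV['F_2]_m)
    (A : {set T}) : 1 < m -> injective c -> unique_pair_sums c A -> m = 2 \/ m = 4.
Proof.
(* The dimension is now [m.+1], so the exponents 1 and 3 correspond to dimensions 2 and 4. *)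
case: m c => // m c m0 c_inj ups.
have eq1 := card_mixed_pair_sums ord0 ups.
have eq2 := card_unique_pair_sums c_inj ups.
rewrite -(cardsID [set i in A | c i ord0 ord0 == 1%R]) in eq2.
have eqI : A :&: [set i in A | c i ord0 ord0 == 1%R] = [set i in A | c i ord0 ord0 == 1%R].
  by apply/setIidPr/subsetP => i; rewrite inE => /andP [].
rewrite eqI in eq2.
by case: (pow2_mul_square_eq eq1 m0 eq2) => ->; auto.
Qed.

(** * Binary columns, and perfect weights versus unique pair sums *)

Lemma binary_col_inj (m : nat) : injective (fun j => col j (binary_mx m)).
Proof.
move=> j k /colP ejk; apply: val_inj => /=.
(* The top row holds the most significant digit, so digit [s] is found in the reversed row. *)
have {}ejk s : s < m -> odd (j %/ 2 ^ s) = odd (k %/ 2 ^ s).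
  move=> sm; have := ejk (rev_ord (Ordinal sm)).
  by rewrite !mxE /= subnSK // subKn ?(ltnW sm) // => /natr_bool_F2_inj.
move: (ltn_ord j) (ltn_ord k); move: (val j) (val k) ejk => {j k}.
elim: m => [|m IH] j k ejk; first by rewrite expn0; lia.
rewrite expnS => hj hk; rewrite -(odd_double_half j) -(odd_double_half k).
have := ejk 0 isT; rewrite expn0 !divn1 => ->; congr (_ + _.*2).
apply: IH; [|lia|lia] => s sm; rewrite -!divn2 -!divnMA -expnS.
exact: ejk.
Qed.

Lemma binary_col_surj (m : nat) (v : 'cV['F_2]_m) :
  exists j, col j (binary_mx m) = v.
Proof.
have := inj_card_onto (@binary_col_inj m).
rewrite card_mx card_Fp // card_ord muln1 leqnn => /(_ isT v) /codomP [j ->].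
by exists j.
Qed.

Lemma big_set2 (R : Type) (idx : R) (op : Monoid.com_law idx) (T : finType)
    (i j : T) (F : T -> R) :
  i != j -> \big[op/idx]_(k in [set i; j]) F k = op (F i) (F j).
Proof. by move=> nij; rewrite big_setU1 ?inE // big_set1. Qed.

Lemma leq_card_weight (n : nat) (pi : 'rV[nat]_n) (B : {set 'I_n}) :
  positive_weights pi -> #|B| <= \sum_(i in B) pi ord0 i.
Proof. by move=> pos; rewrite -sum1_card; apply: leq_sum => i _; apply: pos. Qed.

Lemma perfect_unique_pair_sums (m : nat) (pi : 'rV[nat]_(2 ^ m)) :
  positive_weights pi -> perfect_code pi 2 (ext_hamming_code m) ->
  unique_pair_sums (fun i => col i (binary_mx m)) [set i | pi ord0 i == 1].
Proof.
move=> pos /perfect_ext_hammingP [inj surj]; split.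
  (* [j0] is a base point: once column [j] is [v] plus column [j0], the even set [[set j; j0]] has
     column sum [v], and covering yields a set [B] of weight at most 2 with the same parity and
     sum. *)
  move=> v v0; have [j0 _] := binary_col_surj (0%R : 'cV_m).
  have [j ej] := binary_col_surj (v + col j0 (binary_mx m))%R.
  have nj : j != j0.
    by apply: contraNneq v0 => ejj; move: ej; rewrite ejj -{1}[col _ _]add0r => /addIr <-.
  have [B []] := surj [set j; j0].
  rewrite big_set2 //= ej -addrA; move: (col _ _) => d.
  have /eqP -> : (d + d == 0)%R by rewrite addmx_F2.
  rewrite addr0 cards2 nj /= => wB oddB ev.
  have := leq_trans (leq_card_weight B pos) wB.
  case cB: #|B| oddB => [|[|[|//]]] // _ _.
    by move: v0; rewrite ev (cards0_eq cB) big_set0 eqxx.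
  have /eqP/cards2P [i [k [nik eB]]] := cB.
  move: wB ev; rewrite eB !big_set2 //= => wB ev.
  (* Two positive weights with sum at most 2 are both 1. *)
  have := pos i; have := pos k => pk pi_.
  by exists i, k; rewrite !inE; split=> //; apply/eqP; lia.
move=> i j k l; rewrite !inE => /eqP pi1 /eqP pj1 /eqP pk1 /eqP pl1 nij e.
have nkl : k != l.
  apply: contra nij => /eqP ekl; rewrite -(inj_eq (@binary_col_inj m)) -addmx_F2 e ekl.
  by rewrite addmx_F2.
by apply: inj; rewrite ?cards2 ?nij ?nkl ?big_set2 //= ?pi1 ?pj1 ?pk1 ?pl1.
Qed.

(** With weight 2 off [A], the sets of weight at most 2 are the empty set, the pairs in [A] and all
    singletons. The first two kinds represent each even coset once by the pair-sum property;
    singletons represent each odd coset once because the columns run once through all vectors. *)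
Lemma unique_pair_sums_perfect (m : nat) (A : {set 'I_(2 ^ m)}) :
  unique_pair_sums (fun i => col i (binary_mx m)) A ->
  perfect_code (\row_i (if i \in A then 1 else 2)) 2 (ext_hamming_code m).
Proof.
set pi := (\row_i _)%R; set c := fun i => _; move=> [ex uniq].
have pos : positive_weights pi by move=> i; rewrite mxE; case: ifP.
have c_inj : injective c := @binary_col_inj m.
have sum0 (B : {set 'I_(2 ^ m)}) : \sum_(i in B) pi ord0 i <= 2 -> odd #|B| = false ->
    B = set0 \/ exists i j, [/\ i \in A, j \in A, i != j & B = [set i; j]].
  move=> wB; have := leq_trans (leq_card_weight B pos) wB.
  case cB: #|B| => [|[|[|//]]] // _ _; first by left; apply: cards0_eq.
  right; have /eqP/cards2P [i [j [nij eB]]] := cB; exists i, j.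
  move: wB; rewrite eB big_set2 //= !mxE.
  by case: ifP; case: ifP.
have nz i j : i != j -> (c i + c j)%R <> 0%R.
  by move=> nij /eqP; rewrite addmx_F2 (inj_eq c_inj) (negPf nij).
apply/perfect_ext_hammingP; split=> [B B' wB wB'|B].
  case oB: (odd #|B|) => /esym oB'.
    have c1 (D : {set 'I_(2 ^ m)}) : \sum_(i in D) pi ord0 i <= 2 -> odd #|D| -> exists i, D = [set i].
      move=> wD; have := leq_trans (leq_card_weight D pos) wD.
      by case cD: #|D| => [|[|[|//]]] // _ _; apply/cards1P; rewrite cD.
    have [i ->] := c1 _ wB oB; have [j ->] := c1 _ wB' oB'.
    by rewrite !big_set1 => /c_inj ->.
  case: (sum0 B wB oB) => [->|[i [j [Ai Aj nij ->]]]];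
    case: (sum0 B' wB' oB') => [->|[k [l [Ak Al nkl ->]]]] //;
    rewrite ?big_set0 ?big_set2 //=.
  - by move=> /esym/nz-/(_ nkl).
  - by move=> /nz-/(_ nij).
  - exact: uniq.
case oB: (odd #|B|).
  have [i ei] := binary_col_surj (\sum_(i in B) c i)%R.
  exists [set i]; rewrite !big_set1 cards1 ei; split=> //.
  by rewrite mxE; case: ifP.
have [e0|n0] := eqVneq (\sum_(i in B) c i)%R 0%R.
  by exists set0; rewrite !big_set0 cards0; split.
have [i [j [Ai Aj eij]]] := ex _ n0.
have nij : i != j by apply: contraNneq n0 => e; rewrite -eij e addmx_F2.
by exists [set i; j]; rewrite !big_set2 //= cards2 nij !mxE Ai Aj; split.
Qed.

(** * Deciding the pair-sum property by computation *)

Definition xor_digits (m i j k l : nat) : bool :=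
  all (fun s => odd (i %/ 2 ^ s) (+) odd (j %/ 2 ^ s)
             == odd (k %/ 2 ^ s) (+) odd (l %/ 2 ^ s)) (iota 0 m).

Lemma xor_digitsP (m : nat) (i j k l : 'I_(2 ^ m)) :
  let c i := col i (binary_mx m) in
  reflect (c i + c j = c k + c l)%R (xor_digits m i j k l).
Proof.
move=> c; apply: (iffP allP) => [dig | e s].
  apply/colP => r; rewrite !mxE -!natrD natr_F2 [RHS]natr_F2 !oddD !oddb.
  congr ((_ : bool)%:R)%R; apply/eqP/dig.
  by rewrite mem_iota /= add0n; have := ltn_ord r; lia.
rewrite mem_iota /= add0n => sm.
have /colP/(_ (rev_ord (Ordinal sm))) := e.
rewrite !mxE -!natrD natr_F2 [RHS]natr_F2 !oddD !oddb /= => /natr_bool_F2_inj.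
by rewrite subnSK // subKn ?(ltnW sm) // => /eqP.
Qed.

(** Stated on plain numbers so that it evaluates. Column 0 is zero and the columns from 1 on are the
    nonzero vectors, so comparing with [0] and [l] tests whether a given nonzero vector is a pair
    sum. *)
Definition pair_sums_check (m : nat) (s : seq nat) : bool :=
  all (fun l => has (fun i => has (fun j => xor_digits m i j 0 l) s) s)
      (iota 1 (2 ^ m).-1) &&
  all (fun i => all (fun j => all (fun k => all (fun l =>
    (i != j) ==> xor_digits m i j k l ==>
      ((i == k) && (j == l) || (i == l) && (j == k))) s) s) s) s.

Lemma pair_sums_checkP (m : nat) (s : seq nat) :
  all (fun i => i < 2 ^ m) s -> pair_sums_check m s ->
  unique_pair_sums (fun i => col i (binary_mx m)) [set i : 'I_(2 ^ m) | val i \in s].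
Proof.
move=> /allP ltm /andP [/allP ex uniq]; split=> [v v0|].
  have [l el] := binary_col_surj v.
  have z_lt : 0 < 2 ^ m by rewrite expn_gt0.
  have cz : col (Ordinal z_lt) (binary_mx m) = 0%R.
    by apply/colP => r; rewrite !mxE div0n.
  have l0 : 0 < l.
    rewrite lt0n; apply: contraNneq v0 => l0.
    by rewrite -el -cz; apply/eqP; congr col; apply: val_inj.
  have /ex/hasP [i si /hasP [j sj dig]] : val l \in iota 1 (2 ^ m).-1.
    by rewrite mem_iota l0 add1n prednK //; exact: ltn_ord.
  exists (Ordinal (ltm i si)), (Ordinal (ltm j sj)); rewrite !inE; split=> //.
  rewrite -el -[RHS]add0r -cz.
  exact: (@xor_digitsP m (Ordinal (ltm i si)) (Ordinal (ltm j sj)) (Ordinal z_lt) l dig).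
move=> i j k l; rewrite !inE => si sj sk sl nij /xor_digitsP dig.
have /allP/(_ _ si)/allP/(_ _ sj)/allP/(_ _ sk)/allP/(_ _ sl) := uniq.
rewrite dig /= (inj_eq val_inj) nij /= => /orP [] /andP [/eqP e1 /eqP e2].
  by rewrite (val_inj e1) (val_inj e2).
by rewrite (val_inj e1) (val_inj e2) setUC.
Qed.

Theorem theorem2p6 (m : nat) (hm : 2 <= m) :
  (exists pi : 'rV[nat]_(2 ^ m),
      positive_weights pi /\ perfect_code pi 2 (ext_hamming_code m))
  <-> (m = 2 \/ m = 4).
Proof.
split=> [[pi [pos perf]]|].
  exact: unique_pair_sums_dim (@binary_col_inj m) (perfect_unique_pair_sums pos perf).
move=> m24; have [s ltm chk] :
    exists2 s, all (fun i => i < 2 ^ m) s & pair_sums_check m s.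
  (* The columns are zero and the unit vectors, joined for m = 4 by the all-one vector, column 15.
     In that case the 15 pair sums are the vectors of Hamming weight 1 (four), 2 (six), 3 (four) and
     4 (one). *)
  by case: m24 => ->; [exists [:: 0; 1; 2] | exists [:: 0; 1; 2; 4; 8; 15]];
    vm_compute.
eexists; split; last exact: unique_pair_sums_perfect (pair_sums_checkP ltm chk).
by move=> i; rewrite mxE; case: ifP.
Qed.
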